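(* Let $n\ge 1$ and let $\{a_{ij}\}_{1\le i,j\le n}$ be an arbitrary collection of real numbers. Let $\pi$ be a uniformly random permutation of $\{1,\ldots,n\}$, and let $X=\sum_{i=1}^n a_{i\pi(i)}$. Define the random variable $$\Delta=\frac{1}{4n}\sum_{i=1}^n\sum_{j=1}^n\left(a_{i\pi(i)}+a_{j\pi(j)}-a_{i\pi(j)}-a_{j\pi(i)}\right)^2.$$ Then for every positive integer $k$, $$\mathbb{E}\left[(X-\mathbb{E}(X))^{2k}\right]\le (2k-1)^k\,\mathbb{E}\left[\Delta^k\right].$$
   Context: The numbers $a_{ij}$ are deterministic; the only randomness is in the permutation $\pi$. *)

(* Defs.v *)
From HB Require Import structures.
From mathcomp Require Export all_boot all_order all_algebra perm.
From mathcomp Require Export all_classical all_reals all_analysis.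

Set Implicit Arguments.
Unset Strict Implicit.
Unset Printing Implicit Defensive.

Import Order.TTheory GRing.Theory Num.Theory.

Local Open Scope classical_set_scope.
Local Open Scope ring_scope.

(* [U] carries the discrete sigma-algebra: since [U] is finite, measurability
   of [Z] amounts to measurability of the events [Z = u]. *)
Definition uniformly_distributed (d : measure_display) (T : measurableType d)
    (R : realType) (P : probability T R) (U : finType) (Z : T -> U) : Prop :=
  forall u : U, measurable (Z @^-1` [set u]) /\
    P (Z @^-1` [set u]) = ((#|U|%:R : R)^-1)%:E.

Definition perm_sum (R : realType) (n : nat) (a : 'M[R]_n) (s : 'S_n) : R :=
  \sum_(i < n) a i (s i).

Definition perm_delta (R : realType) (n : nat) (a : 'M[R]_n) (s : 'S_n) : R :=
  1 / (4 * n%:R) *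
    \sum_(i < n) \sum_(j < n)
      (a i (s i) + a j (s j) - a i (s j) - a j (s i)) ^+ 2.

(* Main.v *)
Require Import Defs.
From mathcomp Require Import ring.

(** Exchangeable pairs: let [F] be the centered sum and [F'] its value after
    composing the permutation with the transposition of a pair [(i, j)].
    Averaging [F - F'] over all pairs gives [2/n F]; by the symmetry between
    the permutation and its transposed version,
    [E F^(2k) = 1/(4n) sum_ij E (F^(2k-1) - F'^(2k-1)) (F - F')], which is at
    most [(2k-1) E (F^(2k-2) Delta)] since
    [|x^(2k-1) - y^(2k-1)| <= (2k-1)/2 (x^(2k-2) + y^(2k-2)) |x - y|]. Young's
    inequality for [(F^2)^(k-1) ((2k-1) Delta)] then absorbs [F^(2k)] into the
    left-hand side. *)

Set Implicit Arguments.
Unset Strict Implicit.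
Unset Printing Implicit Defensive.

Import Order.TTheory GRing.Theory Num.Theory.

Local Open Scope classical_set_scope.
Local Open Scope ring_scope.

(** Induction on [k]: right side minus left side at [k.+1] is [v] times the same difference at [k],
    plus [k.+1%:R * (u ^+ k * (u - v) ^+ 2)]. *)
Lemma young_exprn (R : realDomainType) (u v : R) (k : nat) :
  0 <= u -> 0 <= v ->
  k.+1%:R * (u ^+ k * v) <= k%:R * u ^+ k.+1 + v ^+ k.+1.
Proof.
move=> u0 v0; elim: k => [|k IH]; first by rewrite expr0 !mul1r mul0r add0r.
have sq : 0 <= k.+1%:R * (u ^+ k * (u - v) ^+ 2).
  by apply: mulr_ge0 => //; apply: mulr_ge0; [exact: exprn_ge0|exact: sqr_ge0].
have {}IH := ler_wpM2r v0 IH.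
rewrite -subr_ge0; rewrite -subr_ge0 in IH.
apply: le_trans (addr_ge0 sq IH) _.
rewrite le_eqVlt; apply/orP; left; apply/eqP.
by rewrite -[k.+2%:R]natr1 -[k.+1%:R]natr1 !exprS; ring.
Qed.

(** Evenness of [i + j] allows passing to absolute values. The difference then factors into two
    terms of equal sign, by monotonicity of powers. *)
Lemma exprn_mixed_le (R : realDomainType) (x y : R) (i j : nat) :
  ~~ odd (i + j) ->
  x ^+ i * y ^+ j + x ^+ j * y ^+ i <= x ^+ (i + j) + y ^+ (i + j).
Proof.
move=> ev.
have evE (z : R) : z ^+ (i + j) = `|z| ^+ (i + j).
  by rewrite -normrX ger0_norm// exprn_even_ge0.
apply: (@le_trans _ _ (`|x| ^+ i * `|y| ^+ j + `|x| ^+ j * `|y| ^+ i)).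
  by rewrite -!normrX -!normrM lerD// ler_norm.
rewrite (evE x) (evE y) !exprD -subr_ge0.
have -> : `|x| ^+ i * `|x| ^+ j + `|y| ^+ i * `|y| ^+ j -
    (`|x| ^+ i * `|y| ^+ j + `|x| ^+ j * `|y| ^+ i) =
    (`|x| ^+ i - `|y| ^+ i) * (`|x| ^+ j - `|y| ^+ j) by ring.
have [xy|/ltW yx] := leP `|x| `|y|.
  by rewrite mulr_le0// subr_le0 lerXn2r// nnegrE.
by rewrite mulr_ge0// subr_ge0 lerXn2r// nnegrE.
Qed.

(** Factor [x - y] out of the odd powers and pair each term [x ^+ (m.*2 - i) * y ^+ i] of the
    cofactor with its mirror image; [exprn_mixed_le] bounds each of the [m.*2.+1] pairs. *)
Lemma subr_odd_exprn_le (R : realDomainType) (x y : R) (m : nat) :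
  (x - y) * (x ^+ m.*2.+1 - y ^+ m.*2.+1) *+ 2 <=
  (x ^+ m.*2 + y ^+ m.*2) * (x - y) ^+ 2 *+ m.*2.+1.
Proof.
rewrite subrXX mulrA -expr2 -mulrnAr [in leRHS]mulrC -[leRHS]mulrnAr.
rewrite ler_wpM2l ?sqr_ge0//.
rewrite mulr2n {2}(reindex_inj rev_ord_inj)/= -big_split/=.
rewrite -[X in _ *+ X]card_ord -sumr_const; apply: ler_sum => i _ /=.
have le_i : (i <= m.*2)%N by rewrite -ltnS.
rewrite !subSS subKn//.
have := @exprn_mixed_le R x y (m.*2 - i) i.
by rewrite subnK// odd_double => /(_ isT).
Qed.

(** Plain sums over [S] stand for expectations under the uniform law. Involutivity of [tau i] makes
    [s] and [tau i s] exchangeable. *)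
Lemma exchangeable_moment_bound (R : realFieldType) (S I : finType)
    (tau : I -> S -> S) (F : S -> R) (c : R) (m : nat) :
  0 <= c -> (forall i, involutive (tau i)) ->
  (forall s, F s = c * \sum_i (F s - F (tau i s))) ->
  \sum_s F s ^+ m.+1.*2 <=
  m.*2.+1%:R ^+ m.+1 *
    \sum_s (c / 2 * \sum_i (F s - F (tau i s)) ^+ 2) ^+ m.+1.
Proof.
move=> c0 tauK hF.
pose D s := c / 2 * \sum_i (F s - F (tau i s)) ^+ 2.
have D0 s : 0 <= D s.
  by rewrite mulr_ge0 ?divr_ge0// sumr_ge0// => i _; exact: sqr_ge0.
have sum_tau i (G : S -> R) : \sum_s G (tau i s) = \sum_s G s.
  by rewrite [RHS](reindex_inj (inv_inj (tauK i))).
have step : \sum_s F s ^+ m.+1.*2 <= \sum_s F s ^+ m.*2 * (m.*2.+1%:R * D s).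
  pose H i s := (F s - F (tau i s)) * F s ^+ m.*2.+1.
  pose Q i s := F s ^+ m.*2 * (F s - F (tau i s)) ^+ 2.
  (* One factor [F s] is expanded by [hF]; [c] becomes [c / 2] twice, leaving two copies to
     symmetrize. *)
  have -> : \sum_s F s ^+ m.+1.*2 = c / 2 * \sum_i (\sum_s H i s) *+ 2.
    rewrite sumrMnl mulrnAr -mulrnAl.
    have -> : c / 2 *+ 2 = c by rewrite -mulr_natr divfK// pnatr_eq0.
    rewrite exchange_big mulr_sumr; apply: eq_bigr => s _.
    by rewrite doubleS exprS {1}hF -mulrA -mulr_suml.
  have -> : \sum_s F s ^+ m.*2 * (m.*2.+1%:R * D s) =
      c / 2 * \sum_i (\sum_s Q i s) *+ m.*2.+1.
    rewrite sumrMnl exchange_big -[X in _ = _ * X]mulr_natr mulr_suml mulr_sumr.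
    apply: eq_bigr => s _.
    by rewrite -[in RHS]mulr_sumr /D; ring.
  apply: ler_wpM2l; first by rewrite divr_ge0.
  apply: ler_sum => i _.
  (* Reindexing one copy by [tau i] flips the sign of [F s - F (tau i s)]; in [QE] below its square
     is unchanged. *)
  have HE : (\sum_s H i s) *+ 2 =
      \sum_s (F s - F (tau i s)) * (F s ^+ m.*2.+1 - F (tau i s) ^+ m.*2.+1).
    rewrite mulr2n -{2}(sum_tau i) -big_split/=; apply: eq_bigr => s _.
    by rewrite /H tauK; ring.
  have QE : (\sum_s Q i s) *+ 2 =
      \sum_s (F s ^+ m.*2 + F (tau i s) ^+ m.*2) * (F s - F (tau i s)) ^+ 2.
    rewrite mulr2n -{2}(sum_tau i) -big_split/=; apply: eq_bigr => s _.
    by rewrite /Q tauK; ring.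
  rewrite -(ler_pMn2r (isT : (0 < 2)%N)) -[leRHS]mulrnA mulnC mulrnA HE QE.
  by rewrite -!sumrMnl; apply: ler_sum => s _; exact: subr_odd_exprn_le.
(* Young's inequality pointwise, with [u = F s ^+ 2] and [v = m.*2.+1%:R * D s]. *)
have young : m.+1%:R * (\sum_s F s ^+ m.*2 * (m.*2.+1%:R * D s)) <=
    m%:R * (\sum_s F s ^+ m.+1.*2) + \sum_s (m.*2.+1%:R * D s) ^+ m.+1.
  rewrite !mulr_sumr -big_split/=; apply: ler_sum => s _.
  rewrite -!mul2n !exprM; apply: young_exprn; first exact: sqr_ge0.
  by rewrite mulr_ge0.
have : m.+1%:R * (\sum_s F s ^+ m.+1.*2) <=
    m%:R * (\sum_s F s ^+ m.+1.*2) + \sum_s (m.*2.+1%:R * D s) ^+ m.+1.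
  by apply: le_trans young; rewrite ler_pM2l ?ltr0n.
rewrite -natr1 mulrDl mul1r lerD2l mulr_sumr => /le_trans; apply.
by apply: ler_sum => s _; rewrite exprMn.
Qed.

Lemma perm_sum_tperm (R : realType) (n : nat) (a : 'M[R]_n) (s : 'S_n)
    (i j : 'I_n) :
  perm_sum a s - perm_sum a (tperm i j * s)%g =
  a i (s i) + a j (s j) - a i (s j) - a j (s i).
Proof.
have [<-|ij] := eqVneq i j; first by rewrite tperm1 mul1g; ring.
rewrite /perm_sum !(bigD1 (P := predT) i)//=.
rewrite !(bigD1 (P := fun x => x != i) j)//= 1?eq_sym//.
rewrite !permM tpermL tpermR.
have -> : \sum_(x < n | (x != i) && (x != j)) a x ((tperm i j * s)%g x) =
    \sum_(x < n | (x != i) && (x != j)) a x (s x).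
  by apply: eq_bigr => x /andP[xi xj]; rewrite permM tpermD// eq_sym.
by ring.
Qed.

Definition perm_mean (R : realType) (n : nat) (a : 'M[R]_n) : R :=
  n%:R^-1 * \sum_i \sum_j a i j.

(** Over all ordered pairs, each diagonal term [a i (s i)], [a j (s j)] sums to [n] times
    [perm_sum a s], and each cross term to the whole matrix sum, because [s] permutes the
    columns. *)
Lemma centered_perm_sumE (R : realType) (n : nat) (a : 'M[R]_n) (s : 'S_n) :
  (0 < n)%N ->
  perm_sum a s - perm_mean a =
  (2 * n%:R)^-1 * \sum_(ij : 'I_n * 'I_n)
    (perm_sum a s - perm_sum a (tperm ij.1 ij.2 * s)%g).
Proof.
move=> n0; have nN0 : n%:R != 0 :> R by rewrite pnatr_eq0 -lt0n.
rewrite -(pair_bigA _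
  (fun i j => perm_sum a s - perm_sum a (tperm i j * s)%g))/=.
have cross i : \sum_j a i (s j) = \sum_j a i j.
  by rewrite [RHS](reindex_inj (@perm_inj _ s)).
under eq_bigr => i _ do under eq_bigr => j _ do rewrite perm_sum_tperm.
have -> : \sum_(i < n) \sum_(j < n)
      (a i (s i) + a j (s j) - a i (s j) - a j (s i)) =
    n%:R * perm_sum a s + n%:R * perm_sum a s
      - \sum_i \sum_j a i j - \sum_i \sum_j a i j.
  under eq_bigr => i _ do rewrite !sumrB big_split/= sumr_const card_ord cross.
  rewrite !sumrB big_split/= sumr_const card_ord sumrMnl !mulr_natl.
  congr (_ - _); rewrite exchange_big; apply: eq_bigr => j _; exact: cross.
by rewrite /perm_mean; field.
Qed.

(** The centered sums add up to zero: left multiplication by a transposition permutes ['S_n], so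
    every pair contributes zero. *)
Lemma sum_perm_sum (R : realType) (n : nat) (a : 'M[R]_n) :
  (0 < n)%N -> \sum_(s : 'S_n) perm_sum a s = #|{: 'S_n}|%:R * perm_mean a.
Proof.
move=> n0; apply/eqP; rewrite mulr_natl -sumr_const -subr_eq0 -sumrB; apply/eqP.
under eq_bigr => s _ do rewrite centered_perm_sumE//.
rewrite -mulr_sumr exchange_big big1 ?mulr0// => -[i j] _ /=.
by rewrite sumrB [X in X - _](reindex_inj (mulgI (tperm i j))) subrr.
Qed.

Lemma expectation_uniform (d : measure_display) (T : measurableType d)
    (R : realType) (P : probability T R) (U : finType) (Z : T -> U)
    (g : U -> R) :
  uniformly_distributed P Z ->
  ('E_P[fun w => g (Z w)] = (#|U|%:R^-1 * \sum_u g u)%:E)%E.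
Proof.
move=> hZ; rewrite unlock.
(* A finite combination of indicators of the events [Z = u], whose measurability and probability are
   given. *)
have -> : (fun w => (g (Z w))%:E) =
    (fun w => \sum_u (g u)%:E * (\1_(Z @^-1` [set u]) w)%:E)%E.
  apply/funext => w; rewrite (bigD1 (Z w))//= indicE mem_set//= mule1.
  rewrite big1 ?adde0// => u uZ; rewrite indicE memNset ?mule0//= => Zu.
  by rewrite Zu eqxx in uZ.
have intI u : P.-integrable setT (fun w => (\1_(Z @^-1` [set u]) w)%:E).
  by apply: integrable_indic; have [] := hZ u.
rewrite integral_sum//; last by move=> u; exact: integrableZl.
rewrite mulr_sumr -sumEFin; apply: eq_bigr => u _.
have [mZ PZ] := hZ u.
by rewrite integralZl// integral_indic// setIT [X in (_ * X)%E]PZ -EFinM mulrC.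
Qed.

Local Open Scope ereal_scope.

Theorem proposition1p2 (R : realType) (d : measure_display)
    (T : measurableType d) (P : probability T R)
    (n : nat) (hn : (1 <= n)%N) (a : 'M[R]_n)
    (pi : T -> 'S_n) (hpi : uniformly_distributed P pi)
    (k : nat) (hk : (0 < k)%N) :
  let X : T -> R := fun w => perm_sum a (pi w) in
  let Delta : T -> R := fun w => perm_delta a (pi w) in
  'E_P[(fun w => (X w - fine 'E_P[X]) ^+ (2 * k)%N)%R]
    <= ((2 * k%:R - 1) ^+ k)%R%:E * 'E_P[(fun w => Delta w ^+ k)%R].
Proof.
cbv zeta.
have card0 : (0 < #|{: 'S_n}|%:R :> R)%R.
  by rewrite ltr0n; apply/card_gt0P; exists 1%g.
have EX : fine 'E_P[fun w => perm_sum a (pi w)] = perm_mean a.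
  by rewrite (expectation_uniform _ hpi)/= sum_perm_sum// mulKf// gt_eqF.
rewrite EX (expectation_uniform
  (fun s => (perm_sum a s - perm_mean a) ^+ (2 * k))%R hpi).
rewrite (expectation_uniform (fun s => perm_delta a s ^+ k)%R hpi).
rewrite -EFinM lee_fin mulrCA ler_pM2l ?invr_gt0//.
case: k hk => // m _.
pose tau (ij : 'I_n * 'I_n) (s : 'S_n) : 'S_n := (tperm ij.1 ij.2 * s)%g.
pose F (s : 'S_n) := (perm_sum a s - perm_mean a)%R.
have tauK ij : involutive (tau ij) by move=> s; rewrite /tau mulgA tperm2 mul1g.
have FB s ij : (F s - F (tau ij s) = perm_sum a s - perm_sum a (tau ij s))%R.
  by rewrite /F; ring.
(* With [c = 1 / (2 n)], [c / 2] is the prefactor [1 / (4 n)] of [perm_delta]. *)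
have c0 : (0 <= (2 * n%:R)^-1 :> R)%R by rewrite invr_ge0 mulr_ge0.
have linF s : F s = ((2 * n%:R)^-1 * \sum_ij (F s - F (tau ij s)))%R.
  by under eq_bigr => ij _ do rewrite FB; exact: centered_perm_sumE.
have DeltaE s : ((2 * n%:R)^-1 / 2 * \sum_ij (F s - F (tau ij s)) ^+ 2 =
    perm_delta a s)%R.
  rewrite /perm_delta pair_bigA/=; congr (_ * _)%R.
    by field; rewrite pnatr_eq0 -lt0n.
  by apply: eq_bigr => ij _; rewrite FB perm_sum_tperm.
have oddE : (2 * m.+1%:R - 1 = m.*2.+1%:R :> R)%R.
  by rewrite -natrM mul2n doubleS -[in LHS]natr1 addrK.
have := @exchangeable_moment_bound _ _ _ tau F _ m c0 tauK linF.
under [X in (_ <= _ * X)%R -> _]eq_bigr => s _ do rewrite DeltaE.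
by rewrite oddE mul2n.
Qed.
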